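(* Let $G$ be a connected non-complete graph with $n$ vertices, $N=\binom n2$, and define $h(\alpha)=\mathrm{Sz}^{\alpha}(G)-W^{\alpha}(G)$. Let $n_1\ge\dots\ge n_N$ be the values $n_u(v)\cdot n_v(u)$ over edges $uv$ of $G$, ordered decreasingly and padded with zeros to length $N$, and let $d_1\ge\dots\ge d_N$ be the distances between unordered pairs of distinct vertices, ordered decreasingly. Suppose there is an index $j$ such that $n_i\ge d_i$ for all $i\le j$ and $n_i\le d_i$ for all $i>j$. Then for every $\alpha>0$ with $h(\alpha)\ge h(0)$ we have $h'(\alpha)>0$.
   Context: For an edge $uv$ of $G$, $n_u(v)$ is the number of vertices strictly closer to $u$ than to $v$ (including $u$), and $n_v(u)$ symmetrically. $W^{\alpha}(G)=\sum_{\{u,v\}}d(u,v)^{\alpha}$ over unordered pairs of distinct vertices, and $\mathrm{Sz}^{\alpha}(G)=\sum_{uv\in E(G)}(n_u(v)n_v(u))^{\alpha}$. *)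

(* Defs.v *)
From HB Require Import structures.
From mathcomp Require Import all_boot all_order all_algebra.
From mathcomp Require Import all_classical all_reals all_analysis.

Set Implicit Arguments.
Unset Strict Implicit.
Unset Printing Implicit Defensive.

Import Order.TTheory GRing.Theory Num.Theory.
Import numFieldNormedType.Exports.

Local Open Scope ring_scope.

(* A finite simple graph on the vertex type T is a symmetric irreflexive
   e : rel T; these two properties are hypotheses of the theorem. *)

Definition connected_graph (T : finType) (e : rel T) : Prop :=
  forall u v : T, connect e u v.

Definition complete_graph (T : finType) (e : rel T) : Prop :=
  forall u v : T, u != v -> e u v.

Definition has_walk (T : finType) (e : rel T) (u v : T) (k : nat) : bool :=
  [exists p : k.-tuple T, path e u p && (last u p == v)].

(* Least length of a walk from u to v. Lengths below #|T| suffice, since a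
   shortest walk repeats no vertex; the junk value is #|T| when v is not
   reachable from u. *)
Definition gdist (T : finType) (e : rel T) (u v : T) : nat :=
  find (has_walk e u v) (iota 0 #|T|).

(* n_u(v) *)
Definition nclose (T : finType) (e : rel T) (u v : T) : nat :=
  #|[set w : T | (gdist e w u < gdist e w v)%N]|.

(* One ordered representative (u, v) of each unordered pair of distinct
   vertices {u, v}: the one listed in the order of the enumeration of T. *)
Definition vpairs (T : finType) : seq (T * T) :=
  [seq p <- enum {: T * T} | (enum_rank p.1 < enum_rank p.2)%N].

Definition edges (T : finType) (e : rel T) : seq (T * T) :=
  [seq p <- vpairs T | e p.1 p.2].

Definition szprod (T : finType) (e : rel T) (p : T * T) : nat :=
  (nclose e p.1 p.2 * nclose e p.2 p.1)%N.

Definition Wiener (R : realType) (T : finType) (e : rel T) (a : R) : R :=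
  \sum_(p <- vpairs T) (gdist e p.1 p.2)%:R `^ a.

Definition Szeged (R : realType) (T : finType) (e : rel T) (a : R) : R :=
  \sum_(p <- edges e) (szprod e p)%:R `^ a.

Definition hfun (R : realType) (T : finType) (e : rel T) (a : R) : R :=
  Szeged e a - Wiener e a.

Definition distseq (T : finType) (e : rel T) : seq nat :=
  sort geq [seq gdist e p.1 p.2 | p <- vpairs T].

Definition szseq (T : finType) (e : rel T) : seq nat :=
  sort geq [seq szprod e p | p <- edges e]
    ++ nseq ('C(#|T|, 2) - size (edges e)) 0%N.

(* Main.v *)
Require Import Defs.
From HB Require Import structures.
From mathcomp Require Import all_boot all_order all_algebra.
From mathcomp Require Import all_classical all_reals all_analysis.
From mathcomp Require Import zify lra.

Set Implicit Arguments.
Unset Strict Implicit.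
Unset Printing Implicit Defensive.

Import Order.TTheory GRing.Theory Num.Theory.
Import numFieldNormedType.Exports.

(* Replace the padding zeros of the sequence n_i by ones: the result a_i still
   crosses d_i at j, and h(alpha) >= h(0) becomes
   sum d_i^alpha <= sum a_i^alpha. Up to the factor alpha, h'(alpha) is the sum
   of phi(y_i) - phi(z_i), where phi(t) = t ln t, y_i = a_i^alpha and
   z_i = d_i^alpha. By convexity phi(y_i) - phi(z_i) >= (y_i - z_i)(ln z_i + 1),
   and the crossing allows ln z_i to be replaced by ln z_j, so the sum is at
   least (ln z_j + 1) (sum y_i - sum z_i) >= 0. Equality forces a_i = d_i for
   all i, hence W(G) = Sz(G) + (N - |E|) > Sz(G); but W(G) <= Sz(G), because
   each edge of a geodesic from x to y is counted in n_u(v) n_v(u) for the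
   pair {x, y}. *)

Local Open Scope nat_scope.

(** * Walks, distances and geodesics *)

Lemma has_walkP (T : finType) (e : rel T) (u v : T) (k : nat) :
  reflect (exists p, [/\ size p = k, path e u p & last u p = v])
          (has_walk e u v k).
Proof.
apply: (iffP existsP) => [[p /andP[up /eqP lp]]|[p [sp up lp]]].
  by exists p; rewrite size_tuple.
have szp : size p == k by apply/eqP.
by exists (Tuple szp); rewrite /= up lp eqxx.
Qed.

Lemma has_walk_cat (T : finType) (e : rel T) (u w v : T) (i j : nat) :
  has_walk e u w i -> has_walk e w v j -> has_walk e u v (i + j).
Proof.
move=> /has_walkP[p [<- up lp]] /has_walkP[q [<- wq lq]].
apply/has_walkP; exists (p ++ q).
by rewrite size_cat cat_path last_cat up lp wq lq.
Qed.

Lemma has_walk_split (T : finType) (e : rel T) (u v : T) (i j : nat) :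
  has_walk e u v (i + j) ->
  exists2 w, has_walk e u w i & has_walk e w v j.
Proof.
move=> /has_walkP[p [sp]]; rewrite -[p](cat_take_drop i) cat_path last_cat.
move=> /andP[up wp] lp; exists (last u (take i p)); apply/has_walkP.
  by exists (take i p); rewrite size_takel // sp leq_addr.
by exists (drop i p); rewrite size_drop sp addKn.
Qed.

Lemma has_walk1 (T : finType) (e : rel T) (u v : T) :
  has_walk e u v 1 = e u v.
Proof.
apply/has_walkP/idP => [[[|w [|? ?]] [] //= _]|euv].
  by rewrite andbT => ? <-.
by exists [:: v]; rewrite /= euv.
Qed.

Lemma has_walk_sym (T : finType) (e : rel T) (u v : T) (k : nat) :
  symmetric e -> has_walk e u v k = has_walk e v u k.
Proof.
move=> e_sym; suff imp x y : has_walk e x y k -> has_walk e y x k.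
  by apply/idP/idP; apply: imp.
elim: k x y => [|k IHk] x y.
  case/has_walkP=> [[|? ?]] [] //= _ _ <-.
  by apply/has_walkP; exists [::].
rewrite -addn1 => /has_walk_split[w /IHk wx]; rewrite has_walk1 e_sym => wy.
by rewrite addnC; apply: has_walk_cat wx; rewrite has_walk1.
Qed.

Lemma gdist_le (T : finType) (e : rel T) (u v : T) (k : nat) :
  has_walk e u v k -> gdist e u v <= k.
Proof.
move=> uv; rewrite leqNgt; apply/negP => lt_k.
(* [find] never exceeds the length of the list it scans, so [k] lies in the scanned range. *)
have ltk : k < #|T|.
  by rewrite -[#|T|](size_iota 0); apply: leq_trans lt_k (find_size _ _).
by have := before_find 0 lt_k; rewrite nth_iota // add0n uv.
Qed.

Lemma gdist_sym (T : finType) (e : rel T) (u v : T) :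
  symmetric e -> gdist e u v = gdist e v u.
Proof. by move=> e_sym; apply: eq_find => k; apply: has_walk_sym. Qed.

Section Connected.

Variables (T : finType) (e : rel T).
Hypotheses (e_sym : symmetric e) (e_conn : connected_graph e).

(** A connecting path shortens to one without repeated vertices, of length below [#|T|]; hence the
    search succeeds and the junk value never occurs. *)
Lemma has_walk_gdist (u v : T) : has_walk e u v (gdist e u v).
Proof.
have /connectP[p0 up0 lp0] := e_conn u v.
have hw : has (has_walk e u v) (iota 0 #|T|).
  case/shortenP: up0 lp0 => p up uniq_p _ lp.
  apply/hasP; exists (size p); last by apply/has_walkP; exists p.
  by rewrite mem_iota /= add0n -[(size p).+1](card_uniqP uniq_p) max_card.
have := nth_find 0 hw; rewrite nth_iota //.
by move: hw; rewrite has_find size_iota.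
Qed.

Lemma gdist_triangle (u w v : T) : gdist e u v <= gdist e u w + gdist e w v.
Proof. by apply/gdist_le/has_walk_cat; apply: has_walk_gdist. Qed.

Lemma gdist_eq0 (u v : T) : (gdist e u v == 0) = (u == v).
Proof.
apply/eqP/eqP => [d0|<-].
  have := has_walk_gdist u v; rewrite d0.
  by case/has_walkP=> [[|? ?]] [].
apply/eqP; rewrite -leqn0; apply: gdist_le.
by apply/has_walkP; exists [::].
Qed.

(** Cut a shortest walk after [i] and [i.+1] steps: the pieces bound the four distances from above,
    and the triangle inequalities through [u] and [v] turn these bounds into equalities. *)
Lemma geodesic_edge (x y : T) (i : nat) : i < gdist e x y ->
  exists u v, [/\ e u v, gdist e x u = i, gdist e x v = i.+1,
                  gdist e y u = gdist e x y - i
                & gdist e y v = gdist e x y - i.+1].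
Proof.
move=> lt_i; have := has_walk_gdist x y; rewrite -{1}(subnKC lt_i) => xy.
have {xy} [v xv vy] := has_walk_split xy.
have [u xu] : exists2 u, has_walk e x u i & has_walk e u v 1.
  by apply: has_walk_split; rewrite addn1.
rewrite has_walk1 => uv; exists u, v.
have := gdist_le xu; have := gdist_le xv; have := gdist_le vy.
have := gdist_triangle x v y; have := gdist_triangle x u y.
have uy : has_walk e u y (1 + (gdist e x y - i.+1)).
  by apply: has_walk_cat vy; rewrite has_walk1.
have := gdist_le uy; rewrite ![gdist e y _]gdist_sym //.
by move=> ? ? ? ? ? ?; split=> //; lia.
Qed.

End Connected.

(** * Double counting of pairs and edges, and the inequality W <= Sz *)

(** Swapping coordinates exchanges the increasing and the decreasing pairs, and the diagonal adds
    nothing. Sums over all ordered pairs are easier to exchange. *)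
Lemma sum_vpairs_double (T : finType) (F : T -> T -> nat) :
  (forall u v, F u v = F v u) -> (forall u, F u u = 0) ->
  \sum_(p : T * T) F p.1 p.2 = (\sum_(p <- vpairs T) F p.1 p.2).*2.
Proof.
move=> F_sym F_diag.
have swap_inj : injective (fun p : T * T => (p.2, p.1)).
  by move=> [u v] [x y] [-> ->].
rewrite /vpairs big_filter big_enum_cond /=.
rewrite (bigID (fun p : T * T => enum_rank p.1 < enum_rank p.2)) /= -addnn.
congr (_ + _); rewrite [RHS](reindex_inj swap_inj) /=.
rewrite [LHS]big_mkcond [RHS]big_mkcond; apply: eq_bigr => -[u v] _ /=.
rewrite -leqNgt leq_eqVlt; case: eqVneq => [/ord_inj/enum_rank_inj ->|_] /=.
  by rewrite F_diag ltnn.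
by rewrite F_sym.
Qed.

Lemma size_vpairs (T : finType) : size (vpairs T) = 'C(#|T|, 2).
Proof.
rewrite bin2; apply/esym; rewrite -[RHS]doubleK; congr _./2.
rewrite -sum1_size.
(* The constant 1 does not vanish on the diagonal, so it is replaced by the indicator of
   [p.1 != p.2], which agrees with it on [vpairs]. *)
rewrite -[X in _ = X.*2](_ : \sum_(p <- vpairs T) (p.1 != p.2 : nat) = _); last first.
  rewrite !big_filter; apply: eq_bigr => -[u v] /=.
  by case: eqVneq => // ->; rewrite ltnn.
rewrite -(@sum_vpairs_double _ (fun u v => u != v : nat)) => [|u v|u].
- rewrite -(pair_big xpredT xpredT (fun u v : T => u != v : nat)) /=.
  rewrite (eq_bigr (fun _ => #|T|.-1)) ?sum_nat_const // => u _.
  rewrite -(cardC1 u) -sum1_card [RHS]big_mkcond; apply: eq_bigr => v _.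
  by rewrite inE eq_sym; case: eqP.
- by rewrite eq_sym.
- by rewrite eqxx.
Qed.

(** A product of cardinals counts a product set: here the pairs [q] that the edge separates, [q.1]
    on the side of [u] and [q.2] on the side of [v]. *)
Lemma szprodE (T : finType) (e : rel T) (u v : T) :
  szprod e (u, v) = \sum_(q : T * T)
    ((gdist e q.1 u < gdist e q.1 v) && (gdist e q.2 v < gdist e q.2 u)).
Proof.
rewrite /szprod /nclose -cardsX -sum1_card big_mkcond; apply: eq_bigr => q _.
by rewrite !inE; case: ifP.
Qed.

(* Distinct depths along a geodesic give distinct edges separating its ends. *)
Lemma gdist_le_separating (T : finType) (e : rel T) (x y : T) :
  symmetric e -> connected_graph e ->
  gdist e x y <= #|[set p : T * T | [&& e p.1 p.2,
    gdist e x p.1 < gdist e x p.2 & gdist e y p.2 < gdist e y p.1]]|.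
Proof.
move=> e_sym e_conn; set S := [set p | _].
have := @uniq_leq_size _ (iota 0 (gdist e x y))
  [seq gdist e x p.1 | p : T * T in S] (iota_uniq _ _).
rewrite size_iota size_map -cardE; apply=> i; rewrite mem_iota add0n /= => lt_i.
have [u [v [uv xu xv yu yv]]] := geodesic_edge e_sym e_conn lt_i.
apply/mapP; exists (u, v) => //; rewrite mem_enum inE /= uv xu xv yu yv.
by lia.
Qed.

(** After doubling and exchanging sums, the ordered pair [(x, y)] contributes its distance on the
    left and the number of oriented edges separating it on the right. *)
Lemma Wiener_le_Szeged (T : finType) (e : rel T) :
  symmetric e -> connected_graph e ->
  \sum_(p <- vpairs T) gdist e p.1 p.2 <= \sum_(p <- edges e) szprod e p.
Proof.
move=> e_sym e_conn; rewrite -leq_double -sum_vpairs_double; first last.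
- by move=> u; apply/eqP; rewrite gdist_eq0.
- by move=> u v; apply: gdist_sym.
rewrite /edges big_filter [X in _ <= X.*2]big_mkcond /=.
rewrite [X in _ <= X.*2](eq_bigr (fun p : T * T => e p.1 p.2 * szprod e (p.1, p.2))); last first.
  by case=> u v _ /=; case: (e u v); rewrite ?mul1n.
rewrite -(@sum_vpairs_double _ (fun u v => e u v * szprod e (u, v))); first last.
- by move=> u; rewrite szprodE big1 ?muln0 // => q _; rewrite ltnn.
- by move=> u v; rewrite e_sym /szprod /=; congr muln; apply: mulnC.
under [leqRHS]eq_bigr do rewrite szprodE big_distrr /=.
rewrite exchange_big; apply: leq_sum => -[x y] _ /=.
apply: leq_trans (gdist_le_separating x y e_sym e_conn) _.
rewrite -sum1_card big_mkcond; apply: leq_sum => -[u v] _ /=.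
by rewrite inE /=; case: (e u v) => //=; case: ifP.
Qed.

Lemma szprod_gt0 (T : finType) (e : rel T) (u v : T) :
  connected_graph e -> u != v -> 0 < szprod e (u, v).
Proof.
move=> e_conn uv.
have pos x y : x != y -> 0 < nclose e x y.
  move=> xy; apply/card_gt0P; exists x; rewrite inE.
  have /eqP -> : gdist e x x == 0 by rewrite gdist_eq0.
  by rewrite lt0n gdist_eq0.
by rewrite muln_gt0 !pos // eq_sym.
Qed.

(** * Lengths, positivity and monotonicity of the two sequences *)

(** If the filter kept every listed pair, symmetry of [e] would make the graph complete. So at least
    one padding zero exists. *)
Lemma size_edges_lt (T : finType) (e : rel T) :
  symmetric e -> ~ complete_graph e -> size (edges e) < 'C(#|T|, 2).
Proof.
move=> e_sym e_ncomp; rewrite -size_vpairs /edges size_filter.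
rewrite ltn_neqAle count_size -all_count andbT.
apply/negP => /allP all_e; apply: e_ncomp => u v uv.
wlog lt_uv : u v uv / enum_rank u < enum_rank v => [IH|].
  case: (ltngtP (enum_rank u) (enum_rank v)) => [|lt_vu|/ord_inj/enum_rank_inj].
  - exact: IH.
  - by rewrite e_sym IH // eq_sym.
  - by move/eqP; rewrite (negbTE uv).
by apply: (all_e (u, v)); rewrite mem_filter /= lt_uv mem_enum.
Qed.

Lemma size_edges_le (T : finType) (e : rel T) : size (edges e) <= 'C(#|T|, 2).
Proof. by rewrite -size_vpairs size_filter count_size. Qed.

Lemma size_distseq (T : finType) (e : rel T) : size (distseq e) = 'C(#|T|, 2).
Proof. by rewrite size_sort size_map size_vpairs. Qed.

Lemma size_szseq (T : finType) (e : rel T) : size (szseq e) = 'C(#|T|, 2).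
Proof.
by rewrite size_cat size_sort size_map size_nseq subnKC ?size_edges_le.
Qed.

Lemma gdist_vpairs_gt0 (T : finType) (e : rel T) (p : T * T) :
  connected_graph e -> p \in vpairs T -> 0 < gdist e p.1 p.2.
Proof.
move=> e_conn; rewrite mem_filter lt0n gdist_eq0 // => /andP[lt_p _].
by apply: contraTneq lt_p => ->; rewrite ltnn.
Qed.

Lemma szprod_edges_gt0 (T : finType) (e : rel T) (p : T * T) :
  connected_graph e -> p \in edges e -> 0 < szprod e p.
Proof.
case: p => u v e_conn; rewrite !mem_filter => /and3P[_ /= lt_uv _].
by apply: szprod_gt0 => //; apply: contraTneq lt_uv => ->; rewrite ltnn.
Qed.

Lemma nth_distseq_gt0 (T : finType) (e : rel T) (i : nat) :
  connected_graph e -> i < 'C(#|T|, 2) -> 0 < nth 0 (distseq e) i.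
Proof.
move=> e_conn lt_i; have : nth 0 (distseq e) i \in distseq e.
  by rewrite mem_nth // size_distseq.
by rewrite mem_sort => /mapP[p pT ->]; apply: gdist_vpairs_gt0.
Qed.

Lemma nth_distseq_le (T : finType) (e : rel T) (i j : nat) :
  i <= j -> j < 'C(#|T|, 2) -> nth 0 (distseq e) j <= nth 0 (distseq e) i.
Proof.
move=> le_ij lt_j; have geq_trans : transitive geq.
  by move=> y x z xy yz; apply: leq_trans yz xy.
have geq_total : total geq by move=> x y; apply: leq_total.
have := sorted_leq_nth geq_trans leqnn 0 (sort_sorted geq_total _).
by apply=> //; rewrite inE size_distseq //; apply: leq_ltn_trans lt_j.
Qed.

Local Close Scope nat_scope.
Local Open Scope ring_scope.
Local Open Scope classical_set_scope.

(** * Derivatives in the exponent and convexity of t ln t *)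

Lemma is_derive_powR_exponent (R : realType) (x a : R) : 0 < x ->
  is_derive a 1 (powR x) (x `^ a * ln x).
Proof.
move=> x0; have -> : powR x = expR \o ( *%R^~ (ln x)).
  by apply/funext => b; rewrite /powR gt_eqF.
apply: is_derive1_comp.
have -> : *%R^~ (ln x) = ln x \*: id by apply/funext => b /=; rewrite mulrC.
by rewrite -[X in is_derive _ _ _ X]mulr1; apply: is_deriveZ.
Qed.

Lemma is_derive_sum_powR (R : realType) (I : eqType) (s : seq I) (f : I -> nat)
  (a : R) : {in s, forall i, (0 < f i)%N} ->
  is_derive a 1 (fun b : R => \sum_(i <- s) (f i)%:R `^ b)
    (\sum_(i <- s) (f i)%:R `^ a * ln (f i)%:R).
Proof.
elim: s => [|i s IHs] f_gt0.
  rewrite big_nil (_ : (fun _ => _) = cst 0); first exact: is_derive_cst.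
  by apply/funext => b; rewrite big_nil.
rewrite big_cons (_ : (fun _ => _) = powR (f i)%:R +
  (fun b : R => \sum_(i <- s) (f i)%:R `^ b)); last first.
  by apply/funext => b; rewrite big_cons.
apply: is_deriveD.
  by apply: is_derive_powR_exponent; rewrite ltr0n f_gt0 ?mem_head.
by apply: IHs => k ks; rewrite f_gt0 // inE ks orbT.
Qed.

(** Strict convexity of t ln t, obtained from 1 + s < exp s at s = ln z - ln y, multiplied by
    [y]. *)
Lemma xlnx_gt_tangent (R : realType) (y z : R) : 0 < y -> 0 < z -> y != z ->
  (y - z) * (ln z + 1) < y * ln y - z * ln z.
Proof.
move=> y0 z0 yz; have : 1 + (ln z - ln y) < expR (ln z - ln y).
  apply: expR_gt1Dx; rewrite subr_eq0 eq_sym.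
  by apply: contra_neq yz => /ln_inj->.
rewrite expRB !lnK ?posrE // -(ltr_pM2l y0) mulrCA divff ?gt_eqF // mulr1.
by move=> ?; nra.
Qed.

(* The tangent slope [ln z_i + 1] of [t ln t] at [z_i] may be replaced by the
   slope at the crossing point [z_j]: this only decreases [(y_i - z_i) * slope]. *)
Lemma sum_xlnx_lt_of_crossing (R : realType) (n : nat) (y z : 'I_n -> R)
  (j : 'I_n) :
  (forall i, 1 <= y i) -> (forall i, 1 <= z i) ->
  (forall i : 'I_n, (i <= j)%N -> z j <= z i <= y i) ->
  (forall i : 'I_n, (j < i)%N -> y i <= z i <= z j) ->
  \sum_i z i <= \sum_i y i -> (exists i, y i != z i) ->
  \sum_i z i * ln (z i) < \sum_i y i * ln (y i).
Proof.
move=> y1 z1 zy yz le_zy [i0 neq_i0].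
have y0 i : 0 < y i by apply: lt_le_trans (y1 i).
have z0 i : 0 < z i by apply: lt_le_trans (z1 i).
have slope i : (y i - z i) * (ln (z j) + 1) <= (y i - z i) * (ln (z i) + 1).
  case: (leqP i j) => [/zy|/yz] /andP[le1 le2].
    by apply: ler_wpM2l; rewrite ?subr_ge0 // lerD2r ler_ln ?posrE.
  by apply: ler_wnM2l; rewrite ?subr_le0 // lerD2r ler_ln ?posrE.
have tangent_lt i : y i != z i ->
    (y i - z i) * (ln (z j) + 1) < y i * ln (y i) - z i * ln (z i).
  by move=> neq_i; apply: le_lt_trans (slope i) (xlnx_gt_tangent _ _ _).
rewrite -subr_gt0 -sumrB.
have : 0 <= \sum_i (y i - z i) * (ln (z j) + 1).
  rewrite -mulr_suml mulr_ge0 ?sumrB ?subr_ge0 //.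
  by rewrite addr_ge0 // ln_ge0.
(* The term at [i0] gives the strict inequality; the others need only a weak one, with both sides
   zero where [y i = z i]. *)
move=> /le_lt_trans; apply; rewrite (bigD1 i0) //= [ltRHS](bigD1 i0) //=.
rewrite ltr_leD ?tangent_lt //; apply: ler_sum => i _.
have [eq_i|/tangent_lt/ltW //] := eqVneq (y i) (z i).
by rewrite eq_i !subrr mul0r.
Qed.

(** * Sums over the two sequences, and the conclusion *)

(** [maxn 1] turns the padding zeros into ones and leaves the positive edge values unchanged. *)
Lemma big_szseq (V : nmodType) (T : finType) (e : rel T) (F : nat -> V) :
  {in edges e, forall p, (0 < szprod e p)%N} ->
  \sum_(x <- szseq e) F (maxn 1 x)
  = \sum_(p <- edges e) F (szprod e p)
    + F 1%N *+ ('C(#|T|, 2) - size (edges e)).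
Proof.
move=> sz_gt0; rewrite big_cat /=; congr (_ + _); last first.
  by rewrite big_nseq iter_addr_0.
rewrite (perm_big _ (permEl (perm_sort _ _))) big_map /=.
by apply: eq_big_seq => p /sz_gt0 p0; rewrite (maxn_idPr p0).
Qed.

Lemma big_distseq (V : nmodType) (T : finType) (e : rel T) (F : nat -> V) :
  \sum_(x <- distseq e) F x = \sum_(p <- vpairs T) F (gdist e p.1 p.2).
Proof. by rewrite (perm_big _ (permEl (perm_sort _ _))) big_map. Qed.

Lemma szseq_distseq_neq (T : finType) (e : rel T) :
  symmetric e -> connected_graph e -> ~ complete_graph e ->
  exists i : 'I_('C(#|T|, 2)),
    maxn 1 (nth 0%N (szseq e) i) != nth 0%N (distseq e) i.
Proof.
move=> e_sym e_conn e_ncomp; apply/existsP; rewrite -negb_forall.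
apply/negP => /forallP eq_sd.
have szE : (\sum_(x <- szseq e) maxn 1 x =
    \sum_(p <- edges e) szprod e p + ('C(#|T|, 2) - size (edges e)))%N.
  apply: etrans (big_szseq id (fun p => szprod_edges_gt0 e_conn)) _.
  by congr (_ + _)%N; apply: natn.
have sdE : (\sum_(x <- szseq e) maxn 1 x = \sum_(x <- distseq e) x)%N.
  rewrite [LHS](big_nth 0%N) [RHS](big_nth 0%N) size_szseq size_distseq.
  rewrite !big_mkord.
  by apply: eq_bigr => i _; apply/eqP.
have dE : (\sum_(x <- distseq e) x = \sum_(p <- vpairs T) gdist e p.1 p.2)%N.
  exact: (big_distseq e id).
have := Wiener_le_Szeged e_sym e_conn; have := size_edges_lt e_sym e_ncomp.
by rewrite -dE -sdE szE; lia.
Qed.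

Theorem theorem10 (R : realType) (T : finType) (e : rel T)
  (e_sym : symmetric e) (e_irr : irreflexive e)
  (e_conn : connected_graph e) (e_ncomp : ~ complete_graph e)
  (crossing : exists j : 'I_('C(#|T|, 2)),
     (forall i : 'I_('C(#|T|, 2)), (i <= j)%N ->
        (nth 0 (distseq e) i <= nth 0 (szseq e) i)%N) /\
     (forall i : 'I_('C(#|T|, 2)), (j < i)%N ->
        (nth 0 (szseq e) i <= nth 0 (distseq e) i)%N))
  (alpha : R) (alpha_gt0 : 0 < alpha)
  (h_ge : hfun e (0 : R) <= hfun e alpha) :
  derivable (hfun e : R -> R) alpha 1 /\ 0 < (hfun e : R -> R)^`() alpha.
Proof.
have [j [le_ds le_sd]] := crossing.
have sz_gt0 : {in edges e, forall p, (0 < szprod e p)%N}.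
  by move=> p; apply: szprod_edges_gt0.
have hfun_derive : is_derive alpha 1 (hfun e : R -> R)
    (\sum_(p <- edges e) (szprod e p)%:R `^ alpha * ln (szprod e p)%:R
     - \sum_(p <- vpairs T)
         (gdist e p.1 p.2)%:R `^ alpha * ln (gdist e p.1 p.2)%:R).
  apply: is_deriveB; first exact: is_derive_sum_powR.
  by apply: is_derive_sum_powR => p; apply: gdist_vpairs_gt0.
split; first exact: ex_derive.
(* The factor [alpha] is absorbed by alpha ln x = ln (x^alpha), so each summand becomes t ln t at t
   = x^alpha. *)
rewrite derive1E derive_val subr_gt0 -(ltr_pM2l alpha_gt0) !mulr_sumr.
pose N := 'C(#|T|, 2)%N.
pose y (i : 'I_N) : R := (maxn 1 (nth 0%N (szseq e) i))%:R `^ alpha.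
pose z (i : 'I_N) : R := (nth 0%N (distseq e) i)%:R `^ alpha.
have powR_le (m n : nat) : (m <= n)%N -> m%:R `^ alpha <= n%:R `^ alpha :> R.
  by move=> le_mn; rewrite ge0_ler_powR ?nnegrE ?ler0n ?ler_nat // ltW.
have powR_ge1 (m : nat) : (0 < m)%N -> 1 <= m%:R `^ alpha :> R.
  by move=> m_gt0; rewrite -[leLHS](congr1 (@^~ alpha) (powR1 R)) (powR_le 1%N).
have sum_y (F : R -> R) : \sum_i F (y i) =
    \sum_(p <- edges e) F ((szprod e p)%:R `^ alpha)
    + F 1 *+ (N - size (edges e)).
  have := big_szseq (fun m : nat => F (m%:R `^ alpha)) sz_gt0.
  by rewrite powR1 => <-; rewrite (big_nth 0%N) size_szseq big_mkord.
have sum_z (F : R -> R) : \sum_i F (z i) =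
    \sum_(p <- vpairs T) F ((gdist e p.1 p.2)%:R `^ alpha).
  rewrite -(big_distseq e (fun m : nat => F (m%:R `^ alpha))).
  by rewrite (big_nth 0%N) size_distseq big_mkord.
have powR_ln (m : nat) :
    alpha * (m%:R `^ alpha * ln m%:R) = m%:R `^ alpha * ln (m%:R `^ alpha) :> R.
  by rewrite ln_powR mulrCA.
under eq_bigr do rewrite powR_ln; under [ltRHS]eq_bigr do rewrite powR_ln.
rewrite -(sum_z (fun t => t * ln t)).
(* The added ones are invisible here, since 1 ln 1 = 0. *)
have := sum_y (fun t => t * ln t); rewrite ln1 mulr0 mul0rn addr0 => <-.
apply: (sum_xlnx_lt_of_crossing (j := j)); rewrite ?(sum_y id) ?(sum_z id).
- by move=> i; rewrite powR_ge1 // leq_maxl.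
- by move=> i; rewrite powR_ge1 // nth_distseq_gt0.
- move=> i le_ij; rewrite !powR_le ?nth_distseq_le //.
  by rewrite leq_max le_ds ?orbT.
- move=> i lt_ji; apply/andP; split; apply: powR_le.
    (* Raising a zero to one keeps it below [d_i], as distances of distinct vertices are at least
       1. *)
    by rewrite geq_max le_sd // nth_distseq_gt0.
  by rewrite nth_distseq_le // ltnW.
(* At exponent 0 every term is 1, so h(0) = |E| - N; the N - |E| added ones account exactly for this
   constant. *)
- have sum0 (s : seq (T * T)) (f : T * T -> nat) :
      \sum_(p <- s) (f p)%:R `^ 0 = (size s)%:R :> R.
    under eq_bigr do rewrite powRr0.
    by rewrite big_const_seq count_predT iter_addr_0.
  move: h_ge; rewrite /hfun /Szeged /Wiener !sum0 size_vpairs -/N /=.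
  by rewrite natrB ?size_edges_le //; lra.
- have [i neq_i] := szseq_distseq_neq e_sym e_conn e_ncomp.
  exists i; apply: contra_neq neq_i => /(powR_injective alpha_gt0).
  by rewrite !nnegrE !ler0n => /(_ isT isT)/eqP; rewrite eqr_nat => /eqP.
Qed.
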